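(* Let $k\ge 2$ and $n\ge 0$, and let $p$ be either $1$ or a prime. Then $\Delta^{k-1}a_{p,k}(n)=m_n(p)$, where $\Delta$ is the forward difference operator $\Delta s(n)=s(n+1)-s(n)$.
   Context: A partition of $n$ is a weakly decreasing finite sequence of positive integers summing to $n$; $\mathcal P(n)$ is the set of partitions of $n$ (the empty partition being the unique partition of $0$). For a partition $\lambda$ and positive integer $i$, $m_\lambda(i)$ is the number of parts equal to $i$, and $m_n(i)=\sum_{\lambda\in\mathcal P(n)} m_\lambda(i)$. For $\lambda=(\lambda_1,\ldots,\lambda_\ell)$ with $\ell\ge k$, $\mathrm{pre}_k(\lambda)$ is the partition whose parts are the $\binom{\ell}{k}$ products $\lambda_{i_1}\cdots\lambda_{i_k}$ over all $1\le i_1<\cdots<i_k\le\ell$ (with multiplicity); it is undefined if $\ell<k$. $\mathrm{pre}_k(\mathcal P(n))$ is the set of $\mathrm{pre}_k(\lambda)$ for $\lambda\in\mathcal P(n)$ with at least $k$ parts, and $a_{i,k}(n)=\sum_{\nu\in\mathrm{pre}_k(\mathcal P(n))} m_\nu(i)$. *)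

(* Defs.v *)
From mathcomp Require Import all_boot all_order all_algebra.
From mathcomp Require Import finmap.

Set Implicit Arguments.
Unset Strict Implicit.
Unset Printing Implicit Defensive.

Local Open Scope nat_scope.

Definition is_partition (n : nat) (la : seq nat) : bool :=
  [&& sorted geq la, all (fun x => 0 < x) la & sumn la == n].

(* A partition of n has at most n parts, each at most n, so all of them occur
   among the sequences of length at most n over 'I_n.+1; [in_partitions] below
   shows that the bound discards nothing. *)
Definition partitions (n : nat) : {fset seq nat} :=
  [fset la in [seq map val (val t) | t : n.-bseq 'I_n.+1]
     | is_partition n la]%fset.

Lemma in_partitions (n : nat) (la : seq nat) :
  (la \in partitions n) = is_partition n la.
Proof.
rewrite !inE /=; apply: andb_idl => /and3P [_ pos /eqP sum_la].
have le_size : size la <= n.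
  rewrite -sum_la; elim: la pos {sum_la} => //= x s IHs /andP [x_gt0 /IHs le_s].
  by rewrite -add1n leq_add.
have le_part x : x \in la -> x < n.+1.
  rewrite ltnS -sum_la; elim: la {pos sum_la le_size} => //= y s IHs.
  rewrite inE => /orP [/eqP -> | /IHs le_x]; first exact: leq_addr.
  exact: leq_trans le_x (leq_addl _ _).
have size_t : size (map (inord : nat -> 'I_n.+1) la) <= n by rewrite size_map.
apply/mapP; exists (Bseq size_t); first by rewrite mem_enum.
rewrite /= -map_comp -[LHS]map_id; apply/eq_in_map => x /le_part x_lt /=.
by rewrite inordK.
Qed.

Definition part_mult (la : seq nat) (i : nat) : nat := count_mem i la.

Definition total_mult (n i : nat) : nat :=
  \sum_(la <- partitions n) part_mult la i.

(* Only meaningful when k <= size la; otherwise it is the empty sequence. *)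
Definition pre (k : nat) (la : seq nat) : seq nat :=
  sort geq [seq \prod_(j in J) nth 0 la j
               | J : {set 'I_(size la)} <- enum {set 'I_(size la)} & #|J| == k].

(* As a set: partitions with the same image under [pre k] contribute once. *)
Definition pre_partitions (k n : nat) : {fset seq nat} :=
  [fset pre k la | la in partitions n & k <= size la]%fset.

Definition pre_mult (i k n : nat) : nat :=
  \sum_(nu <- pre_partitions k n) part_mult nu i.

Definition forward_diff (s : nat -> int) (n : nat) : int :=
  (s n.+1 - s n)%R.

(* Main.v *)
(* Since [p] is 1 or a prime, a product of [k] parts of [la] equal to [p] uses at
   least [k - 1] parts equal to 1.  A partition [la] with [m >= k - 1] ones is
   determined by [pre k la]: the multiplicity of 1 is 'C(m, k), which gives [m],
   and the multiplicity of [x > 1] is 'C(m, k - 1) times the number of parts of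
   [la] equal to [x], plus a term that depends only on the parts smaller than
   [x].  So no contribution is lost by taking [pre k] of all partitions as a set,
   and the sum in question runs over the partitions of [n], with summand
   'C(m, k - 1) times the multiplicity of [p] in [la] (or 'C(m, k) when [p = 1]).
   Adding a part 1 is a bijection from the partitions of [n] to the partitions of
   [n + 1] containing 1, so by Pascal's rule the forward difference lowers the
   lower index of the binomial coefficient by one. *)

Require Import Defs.
From mathcomp Require Import all_boot all_order all_algebra.
From mathcomp Require Import finmap zify.

Set Implicit Arguments.
Unset Strict Implicit.
Unset Printing Implicit Defensive.

(** * Counting subsets of positions by their product *)

(* The number of subsets of [k] positions in [s] whose entries have product [x],
   provided that the entries of [s] are positive. *)
Fixpoint count_prod (k : nat) (s : seq nat) (x : nat) : nat :=
  if s is y :: s' then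
    count_prod k s' x +
    (if k is k'.+1 then if y %| x then count_prod k' s' (x %/ y) else 0 else 0)
  else (k == 0) && (x == 1).

(** Separating the subsets that avoid [ord0] from those that contain it mirrors the recursion of
    [count_prod] on the head of the list. *)
Lemma sum_set_ordS n (F : {set 'I_n.+1} -> nat) :
  \sum_J F J = \sum_(J : {set 'I_n}) F (lift ord0 @: J) +
               \sum_(J : {set 'I_n}) F (ord0 |: lift ord0 @: J).
Proof.
have ord0N (J : {set 'I_n}) : (ord0 \in lift ord0 @: J) = false.
  by apply/imsetP=> -[j _ /eqP]; rewrite (negbTE (neq_lift _ _)).
have liftK (J : {set 'I_n}) : lift ord0 @^-1: (lift ord0 @: J) = J.
  by apply/setP=> j; rewrite inE (mem_imset _ _ lift_inj).
rewrite (bigID (fun J : {set 'I_n.+1} => ord0 \notin J)) /=; congr addn.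
  rewrite (reindex_onto (fun J : {set 'I_n} => lift ord0 @: J)
                        (fun J => lift ord0 @^-1: J)) /=.
    by apply: eq_bigl => J; rewrite ord0N liftK eqxx.
  move=> J J0; apply/setP=> i; case: (unliftP ord0 i) => [j|] ->.
    by rewrite (mem_imset _ _ lift_inj) inE.
  by rewrite ord0N (negbTE J0).
rewrite (reindex_onto (fun J : {set 'I_n} => ord0 |: lift ord0 @: J)
                      (fun J => lift ord0 @^-1: J)) /=.
  apply: eq_bigl => J; rewrite negbK setU11 /=; apply/eqP/setP=> j.
  by rewrite !inE (mem_imset _ _ lift_inj) eq_sym (negbTE (neq_lift _ _)).
move=> J; rewrite negbK => J0; apply/setP=> i; rewrite !inE.
case: (unliftP ord0 i) => [j|] ->; last by rewrite eqxx J0.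
by rewrite (mem_imset _ _ lift_inj) inE eq_sym (negbTE (neq_lift _ _)).
Qed.

Lemma count_prodE k s x : all (ltn 0) s ->
  count_prod k s x = \sum_(J : {set 'I_(size s)} | #|J| == k)
                       (\prod_(j in J) nth 0 s j == x).
Proof.
elim: s k x => [|y s IHs] k x /=.
  rewrite (big_mkcond (fun J : {set _} => #|J| == k)) (big_pred1 set0) => [_|J].
    by rewrite cards0 big_set0 [0 == k]eq_sym [1 == x]eq_sym; case: (k == 0).
  by apply/esym/eqP; apply/setP=> -[].
move=> /andP[y_gt0 s_gt0]; rewrite [RHS]big_mkcond sum_set_ordS /=.
have liftI (J : {set 'I_(size s)}) : #|lift ord0 @: J| = #|J|.
  exact: card_imset lift_inj.
have ord0N (J : {set 'I_(size s)}) : ord0 \notin lift ord0 @: J.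
  by apply/imsetP=> -[j _ /eqP]; rewrite (negbTE (neq_lift _ _)).
have prodI (J : {set 'I_(size s)}) :
    \prod_(j in lift ord0 @: J) nth 0 (y :: s) j = \prod_(j in J) nth 0 s j.
  rewrite big_imset /=; last by move=> i j _ _; apply: lift_inj.
  by apply: eq_bigr.
congr addn.
  by rewrite IHs // big_mkcond; apply: eq_bigr => J _; rewrite liftI prodI.
transitivity (\sum_(J : {set 'I_(size s)})
   (if #|J|.+1 == k then (y * \prod_(j in J) nth 0 s j == x : nat) else 0)).
  case: k => [|k]; first by rewrite big1.
  case: ifPn => [/dvdnP[z ->]|yNx].
    rewrite mulnK // IHs // big_mkcond; apply: eq_bigr => J _.
    by rewrite eqSS [z * y]mulnC eqn_pmul2l.
  (* If [y] does not divide [x], no subset using the head has product [x]. *)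
  rewrite big1 // => J _; case: ifP => // _; case: eqP => // def_x.
  by rewrite -def_x dvdn_mulr in yNx.
by apply: eq_bigr => J _; rewrite big_setU1 // cardsU1 ord0N liftI prodI.
Qed.

Lemma count_mem_pre k s x : all (ltn 0) s ->
  count_mem x (pre k s) = count_prod k s x.
Proof.
move=> s_gt0; rewrite count_prodE // /pre.
rewrite (permP (permEl (perm_sort _ _))) count_map -sum1_count.
rewrite big_filter_cond big_enum_cond /= big_mkcondr /=.
by apply: eq_bigr => J _ /=; case: eqP.
Qed.

Lemma count_prod0 s x : count_prod 0 s x = (x == 1).
Proof. by elim: s => //= y s ->; rewrite addn0. Qed.

Lemma count_prod1 k s : count_prod k s 1 = 'C(count_mem 1 s, k).
Proof.
elim: s k => [|y s IHs] [|k] //=; first by rewrite IHs !bin0.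
rewrite dvdn1; case: eqP => [->|_]; last by rewrite IHs addn0.
by rewrite divnn !IHs binS.
Qed.

(** An entry [y >= x] exceeds [z], hence does not divide it, and the quotients of [z] stay below
    [x]. *)
Lemma count_prod_filter k s x z : 0 < z < x ->
  count_prod k s z = count_prod k [seq y <- s | y < x] z.
Proof.
elim: s k z => //= y s IHs k z /andP[z_gt0 z_lt]; case: ltnP => [y_lt|y_ge] /=.
  rewrite -IHs ?z_gt0 //; congr addn; case: k => // k; case: ifP => // yz.
  rewrite IHs // divn_gt0 ?(dvdn_gt0 z_gt0) //.
  by rewrite (dvdn_leq z_gt0 yz) (leq_ltn_trans (leq_div _ _)).
rewrite -IHs ?z_gt0 //; case: k => [|k]; first by rewrite addn0.
by rewrite gtnNdvd ?addn0 // (leq_trans z_lt).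
Qed.

(* A product of positive integers equal to [x] with a factor [x] has all its
   other factors equal to 1; without such a factor, all its factors are
   smaller than [x]. *)
Lemma count_prod_split k s x : 1 < x ->
  count_prod k.+1 s x =
    'C(count_mem 1 s, k) * count_mem x s
      + count_prod k.+1 [seq y <- s | y < x] x.
Proof.
move=> x_gt1; have x_gt0 : 0 < x by apply: ltnW.
elim: s k => [|y s IHs] k /=; first by rewrite muln0.
case: (ltngtP y x) => [y_lt|y_gt|->] /=.
- rewrite IHs -!addnA; have [y1|y1] := eqVneq y 1.
    rewrite y1 dvd1n divn1; case: k => [|k].
      by rewrite !count_prod0 !bin0.
    (* The subsets that skip this 1 and those that use it supply the two terms of Pascal's rule. *)
    by rewrite IHs add1n binS add0n mulnDl -!addnA; congr addn; apply: addnCA.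
  rewrite add0n; congr (_ + (_ + _)); case: ifP => // yx.
  (* Here [y > 1], so the quotient [x %/ y] is below [x]. *)
  have y_gt0 := dvdn_gt0 x_gt0 yx; apply: count_prod_filter.
  rewrite divn_gt0 // (dvdn_leq x_gt0 yx) ltn_Pdiv //; lia.
- rewrite IHs gtnNdvd //; have -> : y == 1 = false by lia.
  by rewrite addn0.
- rewrite dvdnn divnn x_gt0 count_prod1 IHs.
  have -> : x == 1 = false by lia.
  by rewrite !add0n add1n mulnS addnC addnA.
Qed.

(** The last term of [count_prod_split] vanishes: a divisor of [p] smaller than [p] is 1, and a
    product of ones is never [p]. *)
Lemma count_prod_prime k s p : prime p ->
  count_prod k.+1 s p = 'C(count_mem 1 s, k) * count_mem p s.
Proof.
move=> p_pr; have p_gt1 := prime_gt1 p_pr.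
rewrite count_prod_split //; apply/eqP; rewrite -[X in _ == X]addn0 eqn_add2l.
have: all (fun y => y < p) [seq y <- s | y < p] by apply: filter_all.
elim: {s}[seq y <- s | y < p] k.+1 => [|y s IHs] j /=; first by lia.
case/andP=> y_lt s_lt; rewrite (eqP (IHs _ s_lt)); case: j => // j.
case: ifP => // yp; have [_ /(_ y yp)] := primeP p_pr.
by case/orP=> /eqP def_y; [rewrite def_y divn1 IHs | rewrite def_y ltnn in y_lt].
Qed.

(** * Recovering a partition from its image under [pre] *)

(** By Pascal's rule, raising [a] by one adds ['C(a, k)], which is positive once [k <= a]. *)
Lemma bin_inj k a b : k <= a -> k <= b -> 'C(a, k.+1) = 'C(b, k.+1) -> a = b.
Proof.
wlog: a b / a < b => [W ka kb eqC|].
  by case: (ltngtP a b) => // ab; [apply: W | symmetry; apply: W].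
move=> ab ka _; have : 'C(a, k.+1) < 'C(a.+1, k.+1).
  by rewrite binS -[X in X < _]addn0 ltn_add2l bin_gt0.
by move/leq_trans/(_ (leq_bin2l k.+1 ab)); rewrite ltn_neqAle => /andP[/eqP].
Qed.

Lemma pre_inj k la mu :
    sorted geq la -> sorted geq mu -> all (ltn 0) la -> all (ltn 0) mu ->
    k <= count_mem 1 la -> k <= count_mem 1 mu ->
  pre k.+1 la = pre k.+1 mu -> la = mu.
Proof.
move=> la_s mu_s la0 mu0 la1 mu1 eq_pre.
have eq_c x : count_prod k.+1 la x = count_prod k.+1 mu x.
  by rewrite -!count_mem_pre // eq_pre.
have geq_tr : transitive geq by move=> a b c; rewrite /geq /=; lia.
have geq_as : antisymmetric geq by move=> a b; rewrite /geq /=; lia.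
have eq1 : count_mem 1 la = count_mem 1 mu.
  by apply: bin_inj la1 mu1 _; rewrite -!count_prod1 eq_c.
have eq_cnt x : count_mem x la = count_mem x mu.
  elim/ltn_ind: x => -[|[|x]] IHx //.
    have no0 s : all (ltn 0) s -> count_mem 0 s = 0.
      by move=> s0; apply/count_memPn/negP => /(allP s0).
    by rewrite !no0.
  have := eq_c x.+2; rewrite (count_prod_split _ la) //.
  rewrite (count_prod_split _ mu) // eq1.
  (* Once the smaller parts agree, the second terms of [count_prod_split] cancel, and then so does
     the binomial factor, positive because [k <= count_mem 1 mu]. *)
  suff -> : [seq y <- la | y < x.+2] = [seq y <- mu | y < x.+2].
    by move/addIn/eqP; rewrite eqn_pmul2l ?bin_gt0 // => /eqP.
  apply: (sorted_eq geq_tr geq_as); rewrite ?sorted_filter //.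
  apply/allP=> z _ /=; rewrite !count_filter; apply/eqP.
  case: (ltnP z x.+2) => z_x.
    have cz s : count (predI (pred1 z) (fun y => y < x.+2)) s = count_mem z s.
      by apply: eq_count => y /=; case: eqP => // ->.
    by rewrite !cz IHx.
  have cz s : count (predI (pred1 z) (fun y => y < x.+2)) s = 0.
    rewrite (eq_count (a2 := pred0)) ?count_pred0 // => y /=.
    by case: eqP => // ->; rewrite ltnNge z_x.
  by rewrite !cz.
apply: (sorted_eq geq_tr geq_as) => //.
by apply/allP=> z _ /=; rewrite eq_cnt.
Qed.

(** * Sums over partitions and their forward differences *)

Lemma sum_reindex (S T : eqType) (h : S -> T) (f : T -> nat) s t :
    uniq s -> uniq t ->
    {in s &, forall x y, 0 < f (h x) -> h x = h y -> x = y} ->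
    (forall y, 0 < f y -> y \in t <-> exists2 x, x \in s & y = h x) ->
  \sum_(y <- t) f y = \sum_(x <- s) f (h x).
Proof.
move=> s_uniq t_uniq h_inj h_im.
have sum_supp (U : eqType) (g : U -> nat) r :
    \sum_(y <- r) g y = \sum_(y <- [seq y <- r | 0 < g y]) g y.
  rewrite big_filter [RHS]big_mkcond; apply: eq_bigr => y _.
  by case: posnP.
rewrite sum_supp [RHS]sum_supp -(big_map h predT f); apply: perm_big.
apply: uniq_perm; rewrite ?filter_uniq //.
  rewrite map_inj_in_uniq ?filter_uniq // => x y.
  rewrite !mem_filter => /andP[fx sx] /andP[_ sy]; exact: h_inj.
move=> y; apply/idP/mapP; rewrite ?mem_filter.
  case/andP=> fy; case/(h_im y fy) => x sx def_y; exists x => //.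
  by rewrite mem_filter -def_y fy.
case=> x; rewrite mem_filter => /andP[fx sx] def_y.
rewrite def_y fx; apply/h_im => //; by exists x.
Qed.

Lemma is_partition_rcons1 n la :
  is_partition n.+1 (rcons la 1) = is_partition n la.
Proof.
rewrite /is_partition all_rcons sumn_rcons addn1 eqSS /=.
rewrite andbCA [RHS]andbCA; apply: andb_id2l => la0; congr andb.
case: la la0 => //= x s xs0; rewrite rcons_path andb_idr // => _.
by rewrite /geq /=; apply: (allP (xs0 : all (ltn 0) (x :: s))); rewrite mem_last.
Qed.

Lemma is_partition_last1 n la : is_partition n la -> 1 \in la ->
  exists mu, la = rcons mu 1.
Proof.
case/lastP: la => // mu x /and3P[mu_s mu0 _] mu1; exists mu; congr rcons.
have : 0 < x by move: mu0; rewrite all_rcons => /andP[].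
suff : x <= 1 by lia.
move: mu1; rewrite mem_rcons inE => /predU1P[<-//|mu1].
have geq_tr : transitive geq by move=> a b c; rewrite /geq /=; lia.
move: mu_s; rewrite (sorted_pairwise geq_tr) pairwise_rcons.
by case/andP=> /allP/(_ _ mu1).
Qed.

Lemma sum_partitionsS n (f : seq nat -> nat) :
    (forall la, 1 \notin la -> f la = 0) ->
  \sum_(la <- partitions n.+1) f la = \sum_(la <- partitions n) f (rcons la 1).
Proof.
move=> f0; apply: (sum_reindex (h := rcons^~ 1)); rewrite ?fset_uniq //.
  by move=> x y _ _ _ /rcons_inj[].
move=> la fla; rewrite in_partitions; split; last first.
  by case=> mu; rewrite in_partitions => mu_n ->; rewrite is_partition_rcons1.
move=> la_n; have la1 : 1 \in la.
  by apply: contraLR fla => /f0->.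
have [mu def_la] := is_partition_last1 la_n la1; exists mu => //.
by rewrite in_partitions -is_partition_rcons1 -def_la.
Qed.

(** Common form of both cases: the weight [f] is constant for [p = 1] and the multiplicity of [p]
    for [p] prime, so that adding a part 1 leaves it unchanged. *)
Definition sum_bin (f : seq nat -> nat) (j n : nat) : nat :=
  \sum_(la <- partitions n) 'C(count_mem 1 la, j) * f la.

Lemma sum_binS f j n : (forall la, f (rcons la 1) = f la) ->
  sum_bin f j.+1 n.+1 = sum_bin f j.+1 n + sum_bin f j n.
Proof.
move=> f1; rewrite /sum_bin sum_partitionsS => [|la la1].
  rewrite -big_split; apply: eq_bigr => la _ /=.
  by rewrite f1 -cats1 count_cat /= addn0 addn1 binS mulnDl.
by rewrite (count_memPn la1).
Qed.

Lemma eq_iter_forward_diff (s t : nat -> int) m :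
  s =1 t -> iter m forward_diff s =1 iter m forward_diff t.
Proof. by move=> st; elim: m => //= m IHm n; rewrite /forward_diff !IHm. Qed.

Lemma iter_forward_diff_sum_bin f i j n : (forall la, f (rcons la 1) = f la) ->
  iter i forward_diff (fun m : nat => (sum_bin f (i + j) m)%:Z%R) n
    = (sum_bin f j n)%:Z%R.
Proof.
move=> f1; elim: i n => // i IHi n; rewrite iterSr -IHi.
apply: eq_iter_forward_diff => m; rewrite /forward_diff addSn sum_binS //; lia.
Qed.

(** * From the set of images to all partitions *)

Lemma pre_multE p k n : p = 1 \/ prime p ->
  pre_mult p k.+1 n = \sum_(la <- partitions n) count_prod k.+1 la p.
Proof.
move=> hp.
have pos la : la \in partitions n -> all (ltn 0) la.
  by rewrite in_partitions => /and3P[].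
have srt la : la \in partitions n -> sorted geq la.
  by rewrite in_partitions => /and3P[].
transitivity (\sum_(la <- partitions n) count_mem p (pre k.+1 la)); last first.
  by apply: eq_big_seq => la /pos la0; rewrite count_mem_pre.
have ones la : la \in partitions n -> 0 < count_mem p (pre k.+1 la) ->
    k <= count_mem 1 la.
  move=> /pos la0; rewrite count_mem_pre //; case: hp => [->|p_pr].
    by rewrite count_prod1 bin_gt0 => /ltnW.
  by rewrite count_prod_prime // muln_gt0 bin_gt0 => /andP[].
apply: (sum_reindex (h := pre k.+1)); rewrite ?fset_uniq //.
  move=> la mu la_n mu_n la_p eq_pre.
  apply: (pre_inj _ _ _ _ _ _ eq_pre); rewrite ?srt ?pos // ones //.
  by rewrite -eq_pre.
move=> nu nu_p; split.
  by case/imfsetP=> la /=; rewrite inE => /andP[la_n _] ->; exists la.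
case=> la la_n def_nu; apply/imfsetP; exists la => //=.
rewrite inE la_n /=; move: nu_p.
rewrite def_nu /part_mult count_mem_pre ?pos // count_prodE ?pos //.
(* With fewer than [k.+1] parts there is no subset of [k.+1] positions, so the count would be 0. *)
apply: contraTT; rewrite -leqNgt -ltnNge => la_k.
rewrite big_pred0 // => J; apply: contraTF la_k => /eqP J_k.
by have := max_card (mem J); rewrite card_ord J_k ltnNge.
Qed.

Theorem theorem3p6 (k n p : nat) (hk : 2 <= k) (hp : p = 1 \/ prime p) :
  iter k.-1 forward_diff (fun m : nat => (pre_mult p k m)%:Z%R) n
    = (total_mult n p)%:Z%R.
Proof.
case: k hk => // k _ /=.
case: (hp) => [p1|p_pr].
  (* The [k] differences stop at ['C(m, 1)], the number [m] of ones. *)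
  rewrite (eq_iter_forward_diff
             (t := fun m => (sum_bin (fun=> 1) (k + 1) m)%:Z%R)).
    rewrite iter_forward_diff_sum_bin // p1; congr (Posz _).
    by apply: eq_bigr => la _; rewrite bin1 muln1.
  move=> m; rewrite pre_multE // p1 addn1; congr (Posz _).
  by apply: eq_bigr => la _; rewrite count_prod1 muln1.
(* Here they stop at ['C(m, 0) = 1], leaving only the weight. *)
rewrite (eq_iter_forward_diff
           (t := fun m => (sum_bin (count_mem p) (k + 0) m)%:Z%R)).
  rewrite iter_forward_diff_sum_bin => [|la].
    by congr (Posz _); apply: eq_bigr => la _; rewrite bin0 mul1n.
  rewrite -cats1 count_cat /= addn0.
  by have := prime_gt1 p_pr; case: eqP => [<-|] //; rewrite addn0.
move=> m; rewrite pre_multE // addn0; congr (Posz _).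
by apply: eq_bigr => la _; rewrite count_prod_prime.
Qed.
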